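(* Let $\mathcal{T},\Sigma\subset\mathbb{N}=\{1,2,\dots\}$ be such that $\mathcal{T}\times\Sigma$ is finite. Then, as $n\to\infty$, $$\mathbb{P}\left(\mathcal{P}_{\mathcal{T},\Sigma,n}\neq\emptyset\right)\to 1-\exp\left(-\lambda_{\mathcal{T},\Sigma}\right),$$ where $\mathcal{P}_{\mathcal{T},\Sigma,n}=\bigcup_{(\tau,\sigma)\in\mathcal{T}\times\Sigma}\mathcal{P}_{\tau,\sigma,n}$ and $$\lambda_{\mathcal{T},\Sigma}=\sum_{(\tau,\sigma)\in\mathcal{T}\times\Sigma}\lambda_{\tau,\sigma},\qquad \lambda_{\tau,\sigma}=\frac{1}{\tau\sigma}\sum_{d\,\mid\,\gcd(\tau,\sigma)}\varphi(d)\,d,$$ with $\varphi$ the Euler totient function. Here $\mathcal{P}_{\tau,\sigma,n}$ is the random set of periodic solutions with temporal period $\tau$ and spatial period $\sigma$ of a uniformly random two-neighbor cellular automaton rule with $n$ states.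
   Context: Let $\mathbb{Z}_n=\{0,1,\dots,n-1\}$. A rule is a function $f:\mathbb{Z}_n^2\to\mathbb{Z}_n$. Given an initial configuration $\xi_0:\mathbb{Z}\to\mathbb{Z}_n$, the rule determines $\xi_t$, $t\ge 0$, by $\xi_{t+1}(x)=f(\xi_t(x-1),\xi_t(x))$ for all $x\in\mathbb{Z}$. A periodic solution (PS) of $f$ with temporal period $\tau\ge1$ and spatial period $\sigma\ge1$ is a space-time configuration $(x,t)\mapsto\xi_t(x)$ generated by $f$ such that $\sigma$ is the smallest positive integer with $\xi_0(x+\sigma)=\xi_0(x)$ for all $x\in\mathbb{Z}$, and $\tau$ is the smallest positive integer with $\xi_\tau(x)=\xi_0(x)$ for all $x\in\mathbb{Z}$. Periodic solutions that differ by a spatial and/or temporal translation are identified. The rule $f$ is chosen uniformly at random from the $n^{n^2}$ rules, i.e. $\mathbb{P}(\{f\})=1/n^{n^2}$ for each rule $f$. *)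

(* Defs.v *)
From mathcomp Require Import all_boot all_order all_algebra.
From mathcomp Require Import all_classical all_reals all_analysis.

Set Implicit Arguments.
Unset Strict Implicit.
Unset Printing Implicit Defensive.

Import Order.TTheory GRing.Theory Num.Theory.
Import numFieldNormedType.Exports.

Local Open Scope classical_set_scope.
Local Open Scope ring_scope.

Definition rule (n : nat) : Type := {ffun 'I_n * 'I_n -> 'I_n}.

(* [xi t x] is the state of site [x] at time [t]. *)
Definition spacetime (n : nat) : Type := nat -> int -> 'I_n.

Definition generated (n : nat) (f : rule n) (xi : spacetime n) : Prop :=
  forall (t : nat) (x : int), xi t.+1 x = f (xi t (x - 1), xi t x).

Definition smallest_positive (Q : nat -> Prop) (k : nat) : Prop :=
  [/\ (0 < k)%N, Q k & forall j : nat, (0 < j)%N -> Q j -> (k <= j)%N].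

Definition periodic_solution (n : nat) (f : rule n) (tau sigma : nat)
    (xi : spacetime n) : Prop :=
  [/\ generated f xi,
      smallest_positive
        (fun s => forall x : int, xi 0%N (x + s%:Z) = xi 0%N x) sigma
    & smallest_positive
        (fun t => forall x : int, xi t x = xi 0%N x) tau].

(* Forward time shifts suffice: a periodic solution is periodic in time, so on
   periodic solutions this is the orbit under all space-time translations. *)
Definition translates (n : nat) (xi : spacetime n) : set (spacetime n) :=
  [set eta | exists (s : nat) (y : int),
     forall (t : nat) (x : int), eta t x = xi (t + s)%N (x + y)].

(* Periodic solutions up to translation: an element is a translation class. *)
Definition PS (n : nat) (f : rule n) (tau sigma : nat) :
    set (set (spacetime n)) :=
  [set translates xi | xi in periodic_solution f tau sigma].

Definition PS_family (n : nat) (f : rule n) (T S : set nat) :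
    set (set (spacetime n)) :=
  \bigcup_(p in T `*` S) PS f p.1 p.2.

Definition rule_prob (R : realType) (n : nat) (A : set (rule n)) : R :=
  \sum_(f : {ffun 'I_n * 'I_n -> 'I_n} | f \in A) 1 / (n ^ (n ^ 2))%:R.

Definition lambda (R : realType) (tau sigma : nat) : R :=
  1 / (tau * sigma)%:R *
  \sum_(d <- divisors (gcdn tau sigma)) (totient d * d)%:R.

Definition lambda_family (R : realType) (T S : set nat) : R :=
  \sum_(p \in T `*` S) lambda R p.1 p.2.

(* Main.v *)
(* A periodic solution whose periods divide M is a map w from the torus
   (Z/M)^2 to the states.  A given w is generated by the random rule with
   probability n^-p, where p counts its distinct neighbourhoods (left state,
   state), and p is at least the number k of distinct states.  As there are
   O(n^k) maps with k states, those with p > k contribute O(1/n).  If p = k and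
   w is generated, the state at a site determines the states to its left and
   below it, so w is injective modulo a sublattice; choosing the translate with
   the smallest state at the origin gives one representative per translation
   class.
   Two such representatives sharing a state form together a pattern with more
   neighbourhoods than states, so dependent pairs of events also contribute
   O(1/n), and the probability that none occurs is the product of the
   1 - n^-k up to O(1/n), hence tends to exp(-lambda), where lambda is the limit
   of the sum of the n^-k.  The admissible sublattices are generated by
   (sigma, 0) and (b, tau / d), where d is the order of b in Z/sigma and d
   divides tau; such a lattice has index tau * sigma / d, and phi(d) elements b
   have order d. *)
Require Import Defs.
From mathcomp Require Import all_boot all_order all_algebra perm.
From mathcomp Require Import all_classical all_reals all_analysis.
From mathcomp Require Import ring lra zify.

Set Implicit Arguments.
Unset Strict Implicit.
Unset Printing Implicit Defensive.

Import Order.TTheory GRing.Theory Num.Theory.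
Import numFieldNormedType.Exports.

Local Open Scope classical_set_scope.
Local Open Scope ring_scope.

(** * Locally dependent events *)

Section Probability.
Variables (R : realFieldType) (F : finType).
Implicit Types A B : pred F.

Definition pr A : R := #|A|%:R / #|F|%:R.

Lemma pr_ge0 A : 0 <= pr A.
Proof. by rewrite /pr divr_ge0. Qed.

Lemma pr_le A B : subpred A B -> pr A <= pr B.
Proof.
move=> sAB; rewrite /pr ler_wpM2r ?invr_ge0// ler_nat.
by apply: subset_leq_card; apply/fintype.subsetP => f; apply: sAB.
Qed.

Lemma eq_pr A B : A =1 B -> pr A = pr B.
Proof. by move=> eAB; rewrite /pr (eq_card eAB). Qed.

Lemma pr0 A : (forall f, ~~ A f) -> pr A = 0.
Proof. by move=> A0; rewrite /pr eq_card0 ?mul0r// => f; apply/negbTE/A0. Qed.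

Lemma pr_le1 A : pr A <= 1.
Proof.
rewrite /pr; have [->|F0] := eqVneq #|F| 0%N; first by rewrite invr0 mulr0.
by rewrite ler_pdivrMr ?ltr0n ?lt0n// mul1r ler_nat max_card.
Qed.

Lemma pr_predT : (0 < #|F|)%N -> pr predT = 1.
Proof. by move=> F0; rewrite /pr divff// pnatr_eq0 -lt0n. Qed.

Lemma pr_split A B :
  pr B = pr (fun f => B f && A f) + pr (fun f => B f && ~~ A f).
Proof.
rewrite /pr -mulrDl -natrD -(cardID A B); congr ((_ + _)%:R / _).
by apply: eq_card => f; rewrite !inE /in_mem /= andbC.
Qed.

Variables (W : eqType) (A : W -> pred F).

Definition avoids (s : seq W) : pred F := fun f => ~~ has (A^~ f) s.

Lemma pr_has_le B s :
  pr (fun f => B f && has (A^~ f) s) <= \sum_(v <- s) pr (fun f => B f && A v f).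
Proof.
elim: s => [|v s IH]; first by rewrite big_nil pr0// => f; rewrite andbF.
rewrite big_cons (pr_split (A v)); apply: lerD.
  by apply: pr_le => f /= /andP[/andP[-> _] ->].
apply: le_trans IH; apply: pr_le => f /= /andP[/andP[->]] /=.
by case: (A v f).
Qed.

Variable dep : rel W.

(* Compare [pr (A w && avoids s)] with [pr (A w) * pr (avoids s)] by first
   discarding from [s] the events that depend on [A w]. *)
Lemma avoids_cons_approx w s :
  (forall s', all (fun v => ~~ dep w v) s' ->
    pr (fun f => A w f && avoids s' f) = pr (A w) * pr (avoids s')) ->
  `| pr (avoids (w :: s)) - (1 - pr (A w)) * pr (avoids s) | <=
  \sum_(v <- s | dep w v) (pr (A w) * pr (A v) + pr (fun f => A w f && A v f)).
Proof.
move=> indep; set s1 := [seq v <- s | ~~ dep w v]; set s2 := [seq v <- s | dep w v].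
have avE f : avoids s f = avoids s1 f && avoids s2 f.
  rewrite /avoids -negb_or; congr negb.
  elim: s @s1 @s2 => //= v s IH; rewrite {}IH.
  by case: (dep w v) => /=; case: (A v f); rewrite /= ?orbT.
have := indep s1 (filter_all _ _); set p := pr (A w) => ind.
have -> : pr (avoids (w :: s)) = pr (avoids s) - pr (fun f => A w f && avoids s f).
  rewrite [in RHS](pr_split (A w)) addrAC.
  have -> : pr (fun f => avoids s f && A w f) = pr (fun f => A w f && avoids s f).
    by apply: eq_pr => f; rewrite andbC.
  by rewrite subrr add0r; apply: eq_pr => f; rewrite /avoids /= negb_or andbC.
have -> : pr (avoids s) = pr (avoids s1) - pr (fun f => avoids s1 f && has (A^~ f) s2).
  rewrite [in RHS](pr_split (avoids s2)).
  have -> : pr (fun f => avoids s1 f && ~~ avoids s2 f) =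
      pr (fun f => avoids s1 f && has (A^~ f) s2).
    by apply: eq_pr => f; rewrite /avoids negbK.
  by rewrite addrK; apply: eq_pr.
have -> : pr (fun f => A w f && avoids s f) = p * pr (avoids s1)
    - pr (fun f => (A w f && avoids s1 f) && has (A^~ f) s2).
  rewrite -ind [in RHS](pr_split (avoids s2)).
  have -> : pr (fun f => (A w f && avoids s1 f) && ~~ avoids s2 f) =
      pr (fun f => (A w f && avoids s1 f) && has (A^~ f) s2).
    by apply: eq_pr => f; rewrite /avoids negbK.
  by rewrite addrK; apply: eq_pr => f; rewrite avE andbA.
have p0 : 0 <= p by apply: pr_ge0.
set x := pr (fun f => avoids s1 f && _); set y := pr (fun f => _ && has _ _).
have x0 : 0 <= x by apply: pr_ge0.
have y0 : 0 <= y by apply: pr_ge0.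
have xle : x <= \sum_(v <- s2) pr (A v).
  apply: le_trans (pr_has_le _ _) _; apply: ler_sum => v _.
  by apply: pr_le => f /= /andP[].
have yle : y <= \sum_(v <- s2) pr (fun f => A w f && A v f).
  apply: le_trans (pr_has_le _ _) _; apply: ler_sum => v _.
  by apply: pr_le => f /= /andP[/andP[-> _] ->].
rewrite big_split/= -mulr_sumr -!(big_filter s) -/s2.
have pxle : p * x <= p * \sum_(v <- s2) pr (A v) by rewrite ler_wpM2l.
have px0 : 0 <= p * x by rewrite mulr_ge0.
set X := p * \sum_(_ <- _) _ in pxle *; set Y := \sum_(_ <- _) _ in yle *.
(* The terms in [pr (avoids s1)] cancel. What remains is a difference of two nonnegative quantities,
   bounded by [Y] and [X]. *)
have -> : pr (avoids s1) - x - (p * pr (avoids s1) - y) - (1 - p) * (pr (avoids s1) - x)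
   = y - p * x by ring.
by rewrite ler_norml; apply/andP; split; lra.
Qed.

Hypothesis F_gt0 : (0 < #|F|)%N.

(** Peel off one event at a time: the head costs the error of [avoids_cons_approx], and the error of
    the tail is multiplied by [1 - pr (A w)], which lies between 0 and 1. As [w] does not recur in
    the tail, pairs with [w = v] drop out. *)
Lemma avoids_approx s : uniq s ->
  {in s, forall w s', all (fun v => ~~ dep w v) s' ->
    pr (fun f => A w f && avoids s' f) = pr (A w) * pr (avoids s')} ->
  `| pr (avoids s) - \prod_(w <- s) (1 - pr (A w)) | <=
  \sum_(w <- s) \sum_(v <- s | dep w v && (w != v))
     (pr (A w) * pr (A v) + pr (fun f => A w f && A v f)).
Proof.
have e0 u v : 0 <= pr (A u) * pr (A v) + pr (fun f => A u f && A v f).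
  by rewrite addr_ge0 ?mulr_ge0 ?pr_ge0.
elim: s => [_ _|w s IH /= /andP[ws us] indep].
  by rewrite !big_nil (@eq_pr _ predT) ?pr_predT// subrr normr0.
have {}IH := IH us (fun v vs => indep v (mem_behead (s := w :: s) vs)).
have hw := avoids_cons_approx s (indep w (mem_head w s)).
set P := \prod_(v <- s) _ in IH; rewrite big_cons -/P.
set p := pr (A w); set q := pr (avoids s) in IH hw.
have -> : pr (avoids (w :: s)) - (1 - p) * P =
  (pr (avoids (w :: s)) - (1 - p) * q) + (1 - p) * (q - P) by ring.
have p0 : 0 <= p by apply: pr_ge0.
have p1 : p <= 1 by apply: pr_le1.
apply: le_trans (ler_normD _ _) _; rewrite big_cons lerD//.
  apply: le_trans hw _; rewrite big_cons eqxx andbF [leLHS]big_seq_cond.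
  rewrite [leRHS]big_seq_cond le_eqVlt; apply/orP; left; apply/eqP.
  apply: eq_bigl => v; case vs: (v \in s) => //=.
  by have [E|] := eqVneq w v; rewrite ?andbT//; rewrite E vs in ws.
rewrite normrM ger0_norm ?subr_ge0//; apply: le_trans (ler_piMl _ _) _ => //.
  by lra.
apply: le_trans IH _; apply: ler_sum => v _; rewrite [leRHS]big_cons.
by case: ifP => // _; rewrite lerDr e0.
Qed.
End Probability.

(** * Uniform functions and counting by image size *)

Section ProductSpace.
Variables (K V : finType).
Implicit Type B : pred {ffun K -> V}.

(** Swapping the values [v] and [v'] at [k] is a bijection between two fibres of [f k] that
    preserves [B], so all [#|V|] fibres meet [B] equally often. *)
Lemma card_agree1 (k : K) (v : V) B :
  (forall f g : {ffun K -> V}, (forall x, x != k -> f x = g x) -> B f = B g) ->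
  (#|fun f : {ffun K -> V} => (f k == v) && B f| * #|V| = #|B|)%N.
Proof.
move=> Bk; rewrite -[RHS]sum1_card.
rewrite (partition_big (fun f : {ffun K -> V} => f k) predT)//=.
rewrite mulnC -sum_nat_const; apply: eq_bigr => v' _.
pose h (f : {ffun K -> V}) := [ffun x => if x == k then tperm v v' (f x) else f x].
have hK : involutive h.
  by move=> f; apply/ffunP => x; rewrite !ffunE; case: eqP => // _; rewrite tpermK.
rewrite -sum1_card (reindex_inj (inv_inj hK)); apply: eq_bigl => f.
rewrite /in_mem /= ffunE eqxx andbC (Bk (h f) f); last first.
  by move=> x /negbTE xk; rewrite ffunE xk.
congr (_ && _).
by rewrite -(inj_eq (@perm_inj _ (tperm v v'))) tpermK tpermL.
Qed.

Lemma card_agree (c : K -> V) (D : seq K) B : uniq D ->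
  (forall f g : {ffun K -> V}, (forall x, x \notin D -> f x = g x) -> B f = B g) ->
  (#|fun f : {ffun K -> V} => all (fun k => f k == c k) D && B f| * #|V| ^ size D
   = #|B|)%N.
Proof.
elim: D => [_ _|k D IH /= /andP[kD uD] Bk].
  by rewrite expn0 muln1; apply: eq_card.
rewrite expnS mulnA -IH//; last first.
  by move=> f g fg; apply: Bk => x; rewrite inE negb_or => /andP[_ /fg].
congr (_ * _)%N.
rewrite -(@card_agree1 k (c k) (fun f => all (fun k => f k == c k) D && B f)).
  by congr (_ * _)%N; apply: eq_card => f; rewrite /in_mem /= andbA.
move=> f g fg; congr (_ && _).
  apply: eq_in_all => x xD; rewrite fg//; apply: contraNneq kD => <-//.
by apply: Bk => x; rewrite inE negb_or => /andP[/fg].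
Qed.

Lemma pr_agree (R : realFieldType) (c : K -> V) (D : seq K) B :
  (0 < #|V|)%N -> uniq D ->
  (forall f g : {ffun K -> V}, (forall x, x \notin D -> f x = g x) -> B f = B g) ->
  pr R (fun f : {ffun K -> V} => all (fun k => f k == c k) D && B f)
  = #|V|%:R ^- size D * pr R B.
Proof.
move=> V0 uD BD; rewrite /pr -(card_agree c uD BD) natrM natrX mulrA; congr (_ / _).
by rewrite mulrCA mulVf ?mulr1// expf_neq0// pnatr_eq0 -lt0n.
Qed.

End ProductSpace.

(** A map with [k] values factors through ['I_k] by numbering its image. *)
Lemma card_codom_eq_le (X V : finType) k :
  (#|fun u : {ffun X -> V} => #|codom u| == k| <= #|V| ^ k * k ^ #|X|)%N.
Proof.
pose phi (p : {ffun 'I_k -> V} * {ffun X -> 'I_k}) := [ffun x => p.1 (p.2 x)].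
rewrite -[k in (#|V| ^ k)%N]card_ord -[k in (k ^ #|X|)%N]card_ord -!card_ffun -card_prod.
apply: leq_trans (leq_image_card phi predT).
apply: subset_leq_card; apply/fintype.subsetP => u /eqP uk.
rewrite {}/phi -uk; apply/fintype.imageP.
exists ([ffun i => enum_val i], [ffun x => enum_rank_in (codom_f u x) (u x)]) => //.
by apply/ffunP => x; rewrite ffunE /= !ffunE enum_rankK_in// codom_f.
Qed.

(** Independent of the number of states: this is the constant in the O(1/n) errors. *)
Definition config_bound (X : finType) : nat := \sum_(k < #|X|.+1) k ^ #|X|.

(** By [card_codom_eq_le], the weight [#|V|^-k] cancels the factor [#|V|^k] in the number of maps
    with [k] values. *)
Lemma sum_codom_le (R : realFieldType) (X V : finType) : (0 < #|V|)%N ->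
  \sum_(u : {ffun X -> V}) #|V|%:R ^- #|codom u| <= (config_bound X)%:R :> R.
Proof.
move=> V0.
have codX (u : {ffun X -> V}) : (#|codom u| < #|X|.+1)%N by rewrite ltnS leq_image_card.
rewrite (partition_big (fun u => Ordinal (codX u)) predT)//= natr_sum.
apply: ler_sum => k _.
rewrite (eq_bigr (fun=> #|V|%:R ^- k)); last by move=> u /eqP <-.
rewrite sumr_const -[_ *+ #|_|]mulr_natl ler_pdivrMr ?exprn_gt0 ?ltr0n//.
rewrite -natrX -natrM ler_nat mulnC.
apply: leq_trans (card_codom_eq_le X V k); apply: subset_leq_card.
by apply/fintype.subsetP => u; rewrite /in_mem /= => /eqP <-.
Qed.

(** * Patterns generated by a rule *)

Section Patterns.
Variables (X : finType) (l d : X -> X) (n : nat).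
Implicit Types (f : {ffun 'I_n * 'I_n -> 'I_n}) (u : {ffun X -> 'I_n}).

Definition gen u : pred {ffun 'I_n * 'I_n -> 'I_n} :=
  fun f => [forall x, f (u (l x), u x) == u (d x)].

Definition nbhd u (x : X) : 'I_n * 'I_n := (u (l x), u x).

(** For a generated pattern this amounts to having as many neighbourhoods as states ([gen_simple],
    [simple_codom_nbhd]). *)
Definition simple u : bool :=
  [forall x, forall y,
    (u x == u y) ==> (u (l x) == u (l y)) && (u (d x) == u (d y))].

Lemma simpleP u : reflect
  (forall x y, u x = u y -> u (l x) = u (l y) /\ u (d x) = u (d y)) (simple u).
Proof.
apply: (iffP forallP) => [H x y /eqP xy|H x].
  by have /forallP/(_ y)/implyP/(_ xy)/andP[/eqP-> /eqP->] := H x.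
by apply/forallP => y; apply/implyP => /eqP/H[-> ->]; rewrite !eqxx.
Qed.

Lemma genP u f : reflect (forall x, f (u (l x), u x) = u (d x)) (gen u f).
Proof. by apply: (iffP forallP) => H x; apply/eqP/H. Qed.

Lemma codom_snd_nbhd u : codom u =i [seq k.2 | k in codom (nbhd u)].
Proof.
move=> a; apply/codomP/fintype.imageP => [[x ->]|[k /codomP[x ->] ->]].
  by exists (nbhd u x); rewrite ?codom_f.
by exists x.
Qed.

Lemma codom_le_nbhd u : (#|codom u| <= #|codom (nbhd u)|)%N.
Proof. by rewrite (eq_card (codom_snd_nbhd u)) leq_image_card. Qed.

(** The second projection maps the neighbourhoods onto the states, so it is injective once there are
    no more neighbourhoods than states. *)
Lemma nbhd_determined u : (#|codom (nbhd u)| <= #|codom u|)%N ->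
  forall x y, u x = u y -> u (l x) = u (l y).
Proof.
move=> le x y xy.
have /fintype.image_injP inj : #|[seq k.2 | k in codom (nbhd u)]| == #|codom (nbhd u)|.
  by rewrite -(eq_card (codom_snd_nbhd u)) eqn_leq codom_le_nbhd le.
by have /(_ xy) [] := inj (nbhd u x) (nbhd u y) (codom_f _ _) (codom_f _ _).
Qed.

Lemma gen_simple u f : gen u f -> (#|codom (nbhd u)| <= #|codom u|)%N -> simple u.
Proof.
move=> /genP uf le; apply/simpleP => x y xy.
have lxy := nbhd_determined le xy.
by split=> //; rewrite -!uf lxy xy.
Qed.

Lemma simple_codom_nbhd u : simple u -> #|codom (nbhd u)| = #|codom u|.
Proof.
move=> /simpleP su; rewrite (eq_card (codom_snd_nbhd u)).
apply/esym/card_in_image.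
move=> _ _ /codomP[x ->] /codomP[y ->] /= xy.
by rewrite /nbhd xy (su _ _ xy).1.
Qed.

Lemma simple_gen u : simple u -> exists f, gen u f.
Proof.
move=> /simpleP su.
(* The rule reads only the right state; simplicity makes its value independent of the picked site,
   and [k.2] is an arbitrary default for states outside the pattern. *)
exists [ffun k => if [pick x | u x == k.2] is Some x then u (d x) else k.2].
apply/genP => x; rewrite ffunE /=; case: pickP => [y /eqP yx|/(_ x)].
  by rewrite (su _ _ yx).2.
by rewrite eqxx.
Qed.

(** Brings generation into the form treated by [pr_agree]: agreement with a fixed function on a
    duplicate-free list. *)
Lemma gen_agree u f0 f : gen u f0 ->
  gen u f = all (fun k => f k == f0 k) (undup (codom (nbhd u))).
Proof.
move=> /genP uf0; apply/genP/allP => [uf k|H x].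
  by rewrite mem_undup => /codomP[x ->]; rewrite uf0 uf.
by rewrite -uf0; apply/eqP/H; rewrite mem_undup; apply: (codom_f (nbhd u)).
Qed.

Lemma size_undup_codom (Y : finType) (h : X -> Y) :
  size (undup (codom h)) = #|codom h|.
Proof. by rewrite -(card_uniqP (undup_uniq _)); apply: eq_card => y; rewrite mem_undup. Qed.

Lemma pr_gen_indep (R : realFieldType) u f0 (B : pred {ffun 'I_n * 'I_n -> 'I_n}) :
  (0 < n)%N -> gen u f0 ->
  (forall f g : {ffun 'I_n * 'I_n -> 'I_n},
     (forall k, k \notin codom (nbhd u) -> f k = g k) -> B f = B g) ->
  pr R (fun f => gen u f && B f) = n%:R ^- #|codom (nbhd u)| * pr R B.
Proof.
move=> n0 uf0 BD.
rewrite (@eq_pr _ _ _ (fun f => all (fun k => f k == f0 k)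
    (undup (codom (nbhd u))) && B f)); last by move=> f; rewrite (gen_agree _ uf0).
rewrite pr_agree ?card_ord ?undup_uniq ?size_undup_codom//.
by move=> f g fg; apply: BD => k kD; apply: fg; rewrite mem_undup.
Qed.

Lemma pr_gen (R : realFieldType) u f0 : (0 < n)%N -> gen u f0 ->
  pr R (gen u) = n%:R ^- #|codom (nbhd u)|.
Proof.
move=> n0 uf0; rewrite (@eq_pr _ _ _ (fun f => gen u f && predT f)); last first.
  by move=> f; rewrite andbT.
rewrite (pr_gen_indep _ n0 uf0)// pr_predT ?mulr1// card_ffun card_ord.
by rewrite expn_gt0 n0.
Qed.

(** If some rule generates [u], failure of simplicity forces an extra neighbourhood, hence another
    factor [1/n]; otherwise the probability is 0. *)
Lemma pr_gen_not_simple (R : realFieldType) u : (0 < n)%N -> ~~ simple u ->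
  pr R (gen u) <= n%:R ^- #|codom u| / n%:R.
Proof.
move=> n0 nsu; have [[f0 uf0]|nof] := pselect (exists f0, gen u f0); last first.
  rewrite pr0 ?mulr_ge0 ?invr_ge0//.
  by move=> f; apply/negP => uf; apply: nof; exists f.
rewrite (pr_gen _ n0 uf0) -invfM -exprSr lef_pV2 ?posrE ?exprn_gt0 ?ltr0n//.
rewrite ler_weXn2l ?ler1n// ltnNge; apply: contra nsu; exact: gen_simple uf0.
Qed.

End Patterns.

(** * Two patterns as one pattern *)

Section Join.
Variables (X : finType) (l d : X -> X) (n : nat).
Implicit Types (w v : {ffun X -> 'I_n}).

(** A pair of patterns becomes one pattern on two disjoint copies of [X], so that the bound for
    non-simple patterns applies to pairs. *)
Definition join_step (h : X -> X) (s : X + X) : X + X :=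
  match s with inl x => inl (h x) | inr x => inr (h x) end.

Definition join w v : {ffun X + X -> 'I_n} :=
  [ffun s => match s with inl x => w x | inr x => v x end].

Lemma gen_join w v f :
  gen (join_step l) (join_step d) (join w v) f = gen l d w f && gen l d v f.
Proof.
apply/genP/andP => [H|[/genP Hw /genP Hv] [x|x]]; last 2 first.
- by rewrite !ffunE /= Hw.
- by rewrite !ffunE /= Hv.
by split; apply/genP => x; [have := H (inl x)|have := H (inr x)]; rewrite !ffunE.
Qed.

Lemma join_inj w v w' v' : join w v = join w' v' -> (w, v) = (w', v').
Proof.
move=> /ffunP E; congr (_, _); apply/ffunP => x.
  by have := E (inl x); rewrite !ffunE.
by have := E (inr x); rewrite !ffunE.
Qed.

(** Inclusion-exclusion: the shared state lies in both images. *)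
Lemma card_codom_join w v x y : w x = v y ->
  (#|codom (join w v)| < #|codom w| + #|codom v|)%N.
Proof.
move=> xy; rewrite -(cardUI (mem (codom w)) (mem (codom v))).
rewrite (@eq_card _ (mem (codom (join w v))) [predU codom w & codom v]).
  rewrite -addn1 leq_add2l; apply/card_gt0P; exists (w x).
  by rewrite !inE codom_f/= xy codom_f.
move=> a; rewrite !inE; apply/codomP/orP.
  by move=> [[z|z] ->]; rewrite ffunE codom_f; [left|right].
by move=> [/codomP[z ->]|/codomP[z ->]]; [exists (inl z)|exists (inr z)]; rewrite ffunE.
Qed.
End Join.

(** * Patterns on the torus *)

Lemma ler_sum_seq_uniq (R : numDomainType) (I : finType) (s : seq I) (F : I -> R) :
  uniq s -> (forall i, 0 <= F i) -> \sum_(i <- s) F i <= \sum_i F i.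
Proof.
move=> us F0; rewrite big_uniq//= [leLHS]big_mkcond; apply: ler_sum => i _.
by case: ifP.
Qed.

Section Torus.
Variables (M n : nat).
Notation torus := ('Z_M * 'Z_M)%type.
Implicit Types (w v : {ffun torus -> 'I_n}) (g h : torus).

Definition left (g : torus) : torus := (g.1 - 1, g.2).
(** Time runs downwards: this is the same site one step later. *)
Definition down (g : torus) : torus := (g.1, g.2 + 1).

Lemma torus_ind (P : torus -> Prop) :
  P 0 -> (forall h, P h -> P (left h)) -> (forall h, P h -> P (down h)) ->
  forall h, P h.
Proof.
(* [x] is written as minus a natural number because [left] subtracts 1. *)
move=> P0 Pl Pd [x y]; rewrite -[x]opprK -[- x]natr_Zp -[y]natr_Zp.
elim: (nat_of_ord y) => [|j IH].
  elim: (nat_of_ord (- x)) => [|i /Pl]; first by rewrite oppr0.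
  by rewrite /left/= -[i.+1%:R]natr1 opprD.
by have := Pd _ IH; rewrite /down/= natr1.
Qed.

Lemma add_left g h : g + left h = left (g + h).
Proof. by apply: injective_projections; rewrite //= addrA. Qed.

Lemma add_down g h : g + down h = down (g + h).
Proof. by apply: injective_projections; rewrite //= addrA. Qed.

Notation simpleT := (@simple _ left down n).
Notation genT := (@gen _ left down n).

(** The coincidence spreads along [left] and [down], whose iterates reach the whole torus from the
    origin. *)
Lemma simple_join_transl w v g g' :
  simple (join_step left) (join_step down) (join w v) -> w g = v g' ->
  forall h, w (g + h) = v (g' + h).
Proof.
move=> /simpleP sj gg'; apply: torus_ind => [|h IH|h IH]; first by rewrite !addr0.
  by have [] := sj (inl (g + h)) (inr (g' + h)); rewrite !ffunE// !add_left.
by have [] := sj (inl (g + h)) (inr (g' + h)); rewrite !ffunE// !add_down.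
Qed.

(** The same propagation inside one pattern; hence the level sets of a simple pattern are the cosets
    of a subgroup of the torus. *)
Lemma simple_transl w g g' : simpleT w -> w g = w g' -> forall h, w (g + h) = w (g' + h).
Proof.
move=> /simpleP sw gg'; apply: torus_ind => [|h IH|h IH]; first by rewrite !addr0.
  by rewrite !add_left (sw _ _ IH).1.
by rewrite !add_down (sw _ _ IH).2.
Qed.

Definition pinned w := [forall g, w 0%R <= w g]%N.

(** If the join were simple, [v] would be a translate of [w]; minimality at both origins makes the
    translation vector a period of [w], so [v = w]. *)
Lemma pinned_join_not_simple w v g g' :
  pinned w -> simpleT w -> pinned v -> w g = v g' -> w != v ->
  ~~ simple (join_step left) (join_step down) (join w v).
Proof.
move=> /forallP pw sw /forallP pv gg'; apply: contra_neqN => sj.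
have tr := simple_join_transl sj gg'.
have vE h : v h = w (g - g' + h).
  have := tr (- g' + h); rewrite !addrA addrN add0r => <-.
  by [].
have w0 : w 0 = w (g - g').
  apply/val_inj/anti_leq/andP; split; first exact: pw.
  have -> : w (g - g') = v 0 by rewrite vE addr0.
  by apply: leq_trans (pv (g' - g)) _; rewrite vE addrA subrK subrr.
by apply/ffunP => h; rewrite vE -[in LHS](add0r h); apply: simple_transl.
Qed.

Definition transl g w : {ffun torus -> 'I_n} := [ffun h => w (g + h)].

Lemma gen_transl g w f : genT w f -> genT (transl g w) f.
Proof.
move=> /genP wf; apply/genP => h.
by rewrite !ffunE add_left add_down wf.
Qed.

Lemma simple_transl_config g w : simpleT w -> simpleT (transl g w).
Proof.
move=> /simpleP sw; apply/simpleP => x y; rewrite !ffunE !add_left !add_down.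
exact: sw.
Qed.

Lemma pinned_transl w : exists g, pinned (transl g w).
Proof.
case: (@arg_minnP torus 0 predT (fun g => w g)) => // g _ gmin.
by exists g; apply/forallP => h; rewrite !ffunE addr0; apply: gmin.
Qed.

Definition meets w v := [exists g, exists g', w g == v g'].

Variable R : realFieldType.

(** A pattern sharing no state with [w] shares no neighbourhood with it, so its generation reads the
    rule only off the neighbourhoods of [w]. *)
Lemma gen_avoids_indep w (s : seq {ffun torus -> 'I_n}) : (0 < n)%N -> simpleT w ->
  all (fun v => ~~ meets w v) s ->
  pr R (fun f => genT w f && avoids genT s f) = pr R (genT w) * pr R (avoids genT s).
Proof.
move=> n0 /simple_gen[f0 wf0] /allP sw.
rewrite (pr_gen_indep R n0 wf0) ?(pr_gen R n0 wf0)//.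
move=> f g fg; rewrite /avoids; congr negb; apply: eq_in_has => v /sw vw.
apply: eq_forallb => x; congr (_ == _); apply: fg.
apply: contra vw => /codomP[y [_ E]].
by apply/existsP; exists y; apply/existsP; exists x; rewrite E.
Qed.

(** Joining is injective, so this is part of the sum over all patterns on the disjoint union. *)
Lemma sum_join_le : (0 < n)%N ->
  \sum_(w : {ffun torus -> 'I_n}) \sum_(v : {ffun torus -> 'I_n})
    n%:R ^- #|codom (join w v)| <= (config_bound (torus + torus)%type)%:R :> R.
Proof.
move=> n0; rewrite pair_big/=.
pose jn p := @join torus n p.1 p.2.
have jinj : injective jn.
  by move=> [w v] [w' v'] /(@join_inj torus n w v w' v').
rewrite -(big_image _ _ jn predT (fun u : {ffun torus + torus -> 'I_n} => n%:R ^- #|codom u|))/=.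
apply: le_trans (ler_sum_seq_uniq _ _) _.
- by rewrite map_inj_uniq ?enum_uniq.
- by move=> u; rewrite invr_ge0 exprn_ge0.
by have := @sum_codom_le R (torus + torus)%type 'I_n; rewrite card_ord => ->.
Qed.

(* Two distinct pinned simple patterns sharing a state form a joint pattern with
   more neighbourhoods than states, so the expected number of such pairs is
   [O(1/n)]. *)
Lemma gen_avoids_approx (s : seq {ffun torus -> 'I_n}) : (0 < n)%N -> uniq s ->
  {in s, forall w, simpleT w && pinned w} ->
  `| pr R (avoids genT s) - \prod_(w <- s) (1 - n%:R ^- #|codom w|) | <=
  2 * (config_bound (torus + torus)%type)%:R / n%:R.
Proof.
move=> n0 us sP.
have sS : {in s, forall w, simpleT w} by move=> w /sP /andP[].
have F0 : (0 < #|{ffun 'I_n * 'I_n -> 'I_n}|)%N by rewrite card_ffun card_ord expn_gt0 n0.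
have prE w : w \in s -> pr R (genT w) = n%:R ^- #|codom w|.
  move=> /sS sw; have [f0 wf0] := simple_gen sw.
  by rewrite (pr_gen R n0 wf0) (simple_codom_nbhd sw).
have := @avoids_approx R _ _ genT meets F0 s us.
rewrite (eq_big_seq (fun w => 1 - n%:R ^- #|codom w|)); last first.
  by move=> w ws; rewrite prE.
move=> H; apply: (le_trans (H _)) => {H}.
  by move=> w /sS sw s'; apply: gen_avoids_indep.
(* For a meeting pair, both the product and the joint probability are at most [n^-k / n], where [k]
   counts the states of the join; hence the factor 2. *)
apply: le_trans (_ : \sum_(w <- s) \sum_(v <- s)
    2 * n%:R ^- #|codom (join w v)| / n%:R <= _).
  rewrite big_seq [leRHS]big_seq; apply: ler_sum => w ws.
  rewrite big_mkcond big_seq [leRHS]big_seq; apply: ler_sum => v vs.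
  have J0 : 0 <= n%:R ^- #|codom (join w v)| / n%:R :> R.
    by rewrite mulr_ge0 ?invr_ge0 ?exprn_ge0.
  case: ifP => [/andP[/existsP[x /existsP[y /eqP xy]] wv]|_]; last first.
    by rewrite -mulrA mulr_ge0.
  rewrite -mulrA mulrDl !mul1r lerD//.
    rewrite !prE// -invfM -exprD -invfM -exprSr.
    rewrite lef_pV2 ?posrE ?exprn_gt0 ?ltr0n// ler_weXn2l ?ler1n//.
    exact: card_codom_join xy.
  rewrite -(@eq_pr _ _ (gen (join_step left) (join_step down) (join w v))); last first.
    by move=> f; rewrite gen_join.
  apply: pr_gen_not_simple => //; have /andP[sw pw] := sP _ ws.
  by have /andP[_ pv] := sP _ vs; apply: (pinned_join_not_simple pw sw pv xy wv).
under eq_bigr do rewrite -mulr_suml -mulr_sumr.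
rewrite -mulr_suml -mulr_sumr ler_wpM2r ?invr_ge0// ler_wpM2l//.
have P0 (u : {ffun torus + torus -> 'I_n}) : 0 <= n%:R ^- #|codom u| :> R.
  by rewrite invr_ge0 exprn_ge0.
apply: le_trans (sum_join_le n0).
apply: le_trans (ler_sum_seq_uniq us _) _; first by move=> w; rewrite sumr_ge0.
by apply: ler_sum => w _; apply: ler_sum_seq_uniq.
Qed.

(** Union bound: the extra factor [1/n] of each pattern survives the summation. *)
Lemma pr_not_simple_le : (0 < n)%N ->
  pr R (fun f => [exists w, ~~ simpleT w && genT w f]) <=
  (config_bound (torus : finType))%:R / n%:R.
Proof.
move=> n0.
set s := enum (fun w => ~~ simpleT w).
apply: le_trans (_ : pr R (fun f => predT f && has (genT^~ f) s) <= _).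
  apply: pr_le => f /existsP[w /andP[sw wf]] /=.
  by apply/hasP; exists w => //; rewrite mem_enum.
apply: le_trans (pr_has_le _ _ _ _) _.
apply: le_trans (_ : \sum_(w <- s) n%:R ^- #|codom w| / n%:R <= _).
  rewrite big_seq [leRHS]big_seq; apply: ler_sum => w; rewrite mem_enum => sw.
  exact: pr_gen_not_simple.
rewrite -mulr_suml ler_wpM2r ?invr_ge0//.
apply: le_trans (ler_sum_seq_uniq (enum_uniq _) _) _.
  by move=> w; rewrite invr_ge0 exprn_ge0.
by have := @sum_codom_le R torus 'I_n; rewrite card_ord => ->.
Qed.

End Torus.

(** * Counting pinned patterns with given level sets *)

(** Transposing [y0] and [y] shows that an injection has its minimum equally often at each point,
    and [n ^_ #|Y|] counts all injections. *)
Lemma card_inj_pinned (Y : finType) (y0 : Y) n :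
  (#|Y| * #|fun u : {ffun Y -> 'I_n} => injectiveb u && [forall y, u y0 <= u y]|
   = n ^_ #|Y|)%N.
Proof.
have -> : (n ^_ #|Y|)%N = #|fun u : {ffun Y -> 'I_n} => injectiveb u|.
  by rewrite -[n in LHS]card_ord -card_inj_ffuns; apply: eq_card => u; rewrite inE.
pose m (u : {ffun Y -> 'I_n}) := [arg min_(y < y0) u y].
rewrite -[RHS]sum1_card (partition_big m predT)//= -sum_nat_const.
apply: eq_bigr => y _.
pose h (u : {ffun Y -> 'I_n}) := [ffun z => u (tperm y0 y z)].
have hK : involutive h by move=> u; apply/ffunP => z; rewrite !ffunE tpermK.
rewrite -sum1_card [RHS](reindex_inj (inv_inj hK)); apply: eq_bigl => u.
rewrite /in_mem /=.
have -> : injectiveb (h u) = injectiveb u.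
  apply/injectiveP/injectiveP => inj z z'.
    move=> E; apply: (@perm_inj _ (tperm y0 y)); apply: inj.
    by rewrite !ffunE !tpermK.
  by rewrite !ffunE => /inj /perm_inj.
apply: andb_id2l => /injectiveP uinj; rewrite /m.
case: arg_minnP => // i _ imin; apply/forallP/eqP => [ymin|iy z].
  apply: (@perm_inj _ (tperm y0 y)); apply: uinj; rewrite tpermR.
  apply/val_inj/anti_leq; rewrite ymin andbT.
  by have := imin y isT; rewrite !ffunE tpermR.
by have := imin (tperm y0 y z) isT; rewrite !ffunE iy tpermR tpermK.
Qed.

Section Quotient.
Variables (T Y : finType) (e : rel T) (rho : Y -> T).
Hypothesis e_equiv : equivalence_rel e.
Hypothesis rho_sep : forall y y', e (rho y) (rho y') -> y = y'.
Hypothesis rho_onto : forall g, exists y, e g (rho y).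
Variables (n : nat) (y0 : Y).
Implicit Type w : {ffun T -> 'I_n}.

Definition respects (w : {ffun T -> 'I_n}) := [forall g, forall g', (w g == w g') == e g g'].

Lemma respectsP w : reflect (forall g g', (w g == w g') = e g g') (respects w).
Proof.
apply: (iffP forallP) => [H g g'|H g]; first by have /forallP/(_ g')/eqP := H g.
by apply/forallP => g'; rewrite H.
Qed.

Let e_refl x : e x x. Proof. by have [] := e_equiv x x x. Qed.
Let eE x y z : e x y -> e x z = e y z. Proof. by have [] := e_equiv x y z. Qed.
Let e_sym x y : e x y = e y x.
Proof. by apply/idP/idP => H; rewrite -(eE _ H) e_refl. Qed.

Lemma respects_factor w : respects w ->
  injective (w \o rho) /\ codom w =i codom (w \o rho).
Proof.
move=> /respectsP wP; split.
  by move=> y y' /= /eqP; rewrite wP => /rho_sep.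
move=> a; apply/codomP/codomP => [[g ->]|[y ->]]; last by exists (rho y).
by have [y gy] := rho_onto g; exists y; apply/eqP; rewrite wP.
Qed.

Lemma card_codom_respects w : respects w -> #|codom w| = #|Y|.
Proof. by move=> /respects_factor[inj E]; rewrite (eq_card E) card_codom. Qed.

(** [Y] indexes a transversal of the classes: restriction along [rho] is inverted by reading [u] at
    the index of the representative of [g]. *)
Lemma card_respects_pinned :
  #|fun w : {ffun T -> 'I_n} => respects w && [forall g, w (rho y0) <= w g]%N| =
  #|fun u : {ffun Y -> 'I_n} => injectiveb u && [forall y, u y0 <= u y]%N|.
Proof.
pose r g := xchoose (rho_onto g); have rP g : e g (rho (r g)) by exact: (xchooseP (rho_onto g)).
have rhoK y : r (rho y) = y by apply/esym/rho_sep/rP.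
pose phi (u : {ffun Y -> 'I_n}) := [ffun g => u (r g)].
have phi_inj : injective phi.
  move=> u u' /ffunP E; apply/ffunP => y.
  by have := E (rho y); rewrite !ffunE rhoK.
rewrite -(fintype.card_image phi_inj); apply: eq_card => w; apply/idP/fintype.imageP.
  move=> /andP[wr /forallP wm]; have [winj _] := respects_factor wr.
  exists [ffun y => w (rho y)].
    apply/andP; split; last by apply/forallP => y; rewrite !ffunE.
    by apply/injectiveP => y y'; rewrite !ffunE => /winj.
  apply/ffunP => g; rewrite !ffunE; apply/eqP.
  by rewrite (respectsP _ wr).
move=> [u /andP[/injectiveP uinj /forallP um] ->]; apply/andP; split.
  apply/respectsP => g g'; rewrite !ffunE (inj_eq uinj).
  rewrite (eE _ (rP g)) [RHS]e_sym (eE _ (rP g')).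
  by apply/eqP/idP => [->|/rho_sep//].
by apply/forallP => g; rewrite !ffunE rhoK.
Qed.
End Quotient.

Lemma eq_Zp_nat M x y : (1 < M)%N -> (x%:R == y%:R :> 'Z_M) = (x == y %[mod M])%N.
Proof. by move=> M1; rewrite -val_eqE /= !val_Zp_nat. Qed.

(** After cancelling the gcd, the cofactor of [b] is coprime to that of [s]. *)
Lemma dvdn_mul_gcd s b k : (0 < s)%N -> (s %| k * b)%N = (s %/ gcdn s b %| k)%N.
Proof.
move=> s0; have g0 : (0 < gcdn s b)%N by rewrite gcdn_gt0 s0.
rewrite -[in LHS](divnK (dvdn_gcdl s b)) -[X in (_ %| k * X)%N](divnK (dvdn_gcdr s b)).
rewrite mulnA dvdn_pmul2r// Gauss_dvdl//.
by rewrite /coprime -(eqn_pmul2r g0) mul1n muln_gcdl !divnK ?dvdn_gcdl ?dvdn_gcdr.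
Qed.

(** * Sublattices with prescribed periods *)

Section Lattice.
Variables (M s t b a : nat).
Notation torus := ('Z_M * 'Z_M)%type.
Hypotheses (M1 : (1 < M)%N) (sM : (s %| M)%N) (tM : (t %| M)%N).
Hypotheses (s0 : (0 < s)%N) (t0 : (0 < t)%N).

(** The subgroup generated by [(s, 0)] and [(b, a)]; natural coefficients suffice because the torus
    is finite. *)
Definition lattice : pred torus :=
  fun h => `[< exists k j : nat, h = ((k * b + j * s)%:R, (k * a)%:R) >].

Let d := (s %/ gcdn s b)%N.
Hypothesis tE : t = (d * a)%N.

Let dP k : (s %| k * b)%N = (d %| k)%N. Proof. exact: dvdn_mul_gcd. Qed.

Let aM : (a %| M)%N. Proof. by apply: dvdn_trans tM; rewrite tE dvdn_mull. Qed.
Let a0 : (0 < a)%N. Proof. by move: t0; rewrite tE muln_gt0 => /andP[]. Qed.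

Let dvdM k : (M %| k * a)%N -> (d %| k)%N.
Proof. by move=> /(dvdn_trans tM); rewrite tE dvdn_pmul2r. Qed.

Lemma eq_Zp_dvd q x y : (q %| M)%N -> x%:R = y%:R :> 'Z_M -> x = y %[mod q].
Proof.
move=> qM /eqP; rewrite eq_Zp_nat// => /eqP E.
by rewrite -(modn_dvdm x qM) E modn_dvdm.
Qed.

Lemma latticeP h : reflect
  (exists k j : nat, h = ((k * b + j * s)%:R, (k * a)%:R)) (lattice h).
Proof. exact: asboolP. Qed.

Lemma lattice0 : lattice 0.
Proof. by apply/latticeP; exists 0%N, 0%N. Qed.

Lemma latticeD g h : lattice g -> lattice h -> lattice (g + h).
Proof.
move=> /latticeP[k [j ->]] /latticeP[k' [j' ->]]; apply/latticeP.
exists (k + k')%N, (j + j')%N.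
by apply: injective_projections; rewrite /= -natrD; congr (_%:R); lia.
Qed.

Lemma latticeN h : lattice h -> lattice (- h).
Proof.
move=> H; have Hn m : lattice (h *+ m).
  by elim: m => [|m IH]; rewrite ?mulr0n ?lattice0// mulrS latticeD.
(* The torus has exponent [M], so opposites are multiples. *)
suff -> : - h = h *+ M.-1 by [].
apply/eqP; rewrite eq_sym -addr_eq0 -mulrSr prednK ?(ltnW M1)//.
have MZ (x : 'Z_M) : x *+ M = 0.
  by rewrite -mulr_natl pchar_Zp ?mul0r.
by case: h {H Hn} => x y; rewrite pairMnE !MZ.
Qed.

(** A combination with second coordinate 0 has [M | k * a], so [d | k] and [s | k * b]: only
    multiples of [s] are left in the row. *)
Lemma lattice_row x : lattice (x%:R, 0) = (s %| x)%N.
Proof.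
apply/latticeP/idP => [[k [j [xE kaE]]]|/dvdnP[j ->]]; last by exists 0%N, j.
have := eq_Zp_dvd sM xE; move/eqP; have sk : (s %| k * b)%N.
  rewrite dP; apply: dvdM; apply/eqP.
  by have := eq_Zp_dvd (x := 0) (dvdnn M) kaE; rewrite mod0n.
by rewrite -modnDml (eqP sk) add0n modnMl.
Qed.

(** First coordinate 0 forces [d | k], and [k * a] is then a multiple of [d * a = t]. *)
Lemma lattice_col y : lattice (0, y%:R) = (t %| y)%N.
Proof.
apply/latticeP/idP => [[k [j [E yE]]]|/dvdnP[q ->]].
  have sk : (s %| k * b)%N.
    have /esym/eqP := eq_Zp_dvd (x := 0) sM E.
    rewrite mod0n -/(dvdn s (k * b + j * s)) dvdn_addl//.
    exact: dvdn_mull.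
  rewrite /dvdn (eq_Zp_dvd tM yE) -/(dvdn t (k * a)) tE dvdn_pmul2r//.
  by rewrite -dP.
have /dvdnP[c cE] : (s %| d * q * b)%N by rewrite dP dvdn_mulr.
(* [c * M.-1] stands for [-c] modulo [M]: it cancels the horizontal part [c * s]. *)
exists (d * q)%N, (c * M.-1)%N; congr (_, _); last by rewrite tE; congr (_%:R); lia.
rewrite cE; apply/eqP; rewrite -[0]/(0%:R) eq_Zp_nat//.
have -> : (c * s + c * M.-1 * s = c * s * M)%N.
  by rewrite -[in RHS](prednK (ltnW M1)); nia.
by rewrite modnMl mod0n.
Qed.

Definition lattice_eq : rel torus := fun g g' => lattice (g - g').

Lemma lattice_eq_equiv : equivalence_rel lattice_eq.
Proof.
move=> x y z; split; first by rewrite /lattice_eq subrr lattice0.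
rewrite /lattice_eq => xy; apply/idP/idP => H.
  by rewrite -(subrK x y) -addrA latticeD// -opprB latticeN.
by rewrite -(subrK y x) -addrA latticeD.
Qed.

(** The [s] by [a] rectangle is a fundamental domain, so the lattice has index [s * a]. *)
Definition lattice_rep (y : 'I_s * 'I_a) : torus := (y.1%:R, y.2%:R).

Lemma lattice_rep_sep y y' :
  lattice_eq (lattice_rep y) (lattice_rep y') -> y = y'.
Proof.
case: y y' => [i j] [i' j'] /latticeP[k [l [/= iE jE]]].
have {}iE : i%:R = (k * b + l * s + i')%:R :> 'Z_M by rewrite natrD -iE subrK.
have {}jE : j%:R = (k * a + j')%:R :> 'Z_M by rewrite natrD -jE subrK.
have jj' : j = j'.
  apply/val_inj; have := eq_Zp_dvd aM jE.
  by rewrite modnMDl !modn_small.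
congr (_, _) => //; apply/val_inj.
have sk : (s %| k * b)%N.
  rewrite dP; apply: dvdM; have := eq_Zp_dvd (dvdnn M) jE; rewrite jj' => /eqP.
  by rewrite -[X in X == _ %[mod _]]add0n eqn_modDr mod0n eq_sym.
have := eq_Zp_dvd sM iE; rewrite -addnA -modnDml (eqP sk) add0n modnMDl.
by rewrite !modn_small.
Qed.

Lemma lattice_rep_onto g : exists y, lattice_eq g (lattice_rep y).
Proof.
(* [q] copies of [(b, a)] are subtracted to bring [y] below [a]; [z] is [x - q * b] modulo [M], then
   reduced modulo [s]. *)
case: g => x y; pose q := (y %/ a)%N; pose z := (x + q * b * M.-1)%N.
exists (Ordinal (ltn_pmod z s0), Ordinal (ltn_pmod y a0)).
apply/latticeP; exists q, (z %/ s)%N; apply/eqP; rewrite /lattice_rep /=.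
have -> : (x, y) - ((z %% s)%N%:R, (y %% a)%N%:R)
  = (x - (z %% s)%N%:R, y - (y %% a)%N%:R) :> torus by [].
rewrite xpair_eqE !subr_eq -!natrD -addnA -!divn_eq natr_Zp eqxx andbT.
rewrite -{1}[x]natr_Zp eq_Zp_nat// /z.
have -> : (q * b + (x + q * b * M.-1) = x + q * b * M)%N.
  have -> : (q * b * M = q * b * M.-1 + q * b)%N by rewrite -mulnSr prednK// ltnW.
  by rewrite addnCA (addnC (q * b)%N).
by rewrite addnC modnMDl.
Qed.

Variable n : nat.
Implicit Type w : {ffun torus -> 'I_n}.

Let a_pos : 'I_a := Ordinal a0.
Let s_pos : 'I_s := Ordinal s0.

Lemma card_codom_lattice w : respects lattice_eq w -> #|codom w| = (s * a)%N.
Proof.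
move=> wr; rewrite (card_codom_respects lattice_rep_sep lattice_rep_onto wr).
by rewrite card_prod !card_ord.
Qed.

Lemma card_lattice_pinned :
  (s * a * #|fun w => respects lattice_eq w && pinned w| = n ^_ (s * a))%N.
Proof.
have := card_respects_pinned lattice_eq_equiv lattice_rep_sep lattice_rep_onto n
  (s_pos, a_pos).
have -> : lattice_rep (s_pos, a_pos) = 0 by [].
move=> ->; have := card_inj_pinned (s_pos, a_pos) n.
by rewrite card_prod !card_ord.
Qed.

(** A coincidence depends only on the difference of the two sites, so every translation preserves
    it. *)
Lemma respects_lattice_simple w : respects lattice_eq w -> simple (@left M) (@down M) w.
Proof.
move=> /respectsP wr; apply/simpleP => x y /eqP xy.
have E g : w (g + x) = w (g + y).
  by apply/eqP; rewrite wr /lattice_eq opprD addrACA subrr add0r -/(lattice_eq x y) -wr.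
have lE (h : torus) : left h = left 0 + h by rewrite addrC add_left addr0.
have dE (h : torus) : down h = down 0 + h by rewrite addrC add_down addr0.
by rewrite (lE x) (lE y) (dE x) (dE y) !E.
Qed.

Lemma respects_lattice_row w x : respects lattice_eq w ->
  (w (x%:R, 0) == w 0) = (s %| x)%N.
Proof. by move=> /respectsP wr; rewrite wr /lattice_eq subr0 lattice_row. Qed.

Lemma respects_lattice_col w y : respects lattice_eq w ->
  (w (0, y%:R) == w 0) = (t %| y)%N.
Proof. by move=> /respectsP wr; rewrite wr /lattice_eq subr0 lattice_col. Qed.

End Lattice.

Lemma smallest_positive_dvd (Q : nat -> Prop) k :
  (forall i j, Q i -> Q j <-> Q (i + j)%N) ->
  smallest_positive Q k -> forall x, Q x <-> (k %| x)%N.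
Proof.
move=> QD [k0 Qk kmin].
have Q0 : Q 0%N by apply: (QD k 0%N Qk).2; rewrite addn0.
have Qm q : Q (q * k)%N by elim: q => // q IH; rewrite mulSn; apply: (QD _ _ Qk).1.
move=> x; split; last by move=> /dvdnP[q ->].
rewrite {1}(divn_eq x k) => /(QD _ _ (Qm _)).2 Qr.
rewrite /dvdn; apply: contraT; rewrite -lt0n => r0.
by have := kmin _ r0 Qr; rewrite leqNgt ltn_pmod.
Qed.

Lemma dvd_smallest_positive (Q : nat -> Prop) k : (0 < k)%N ->
  (forall x, Q x <-> (k %| x)%N) -> smallest_positive Q k.
Proof.
move=> k0 QE; split=> //; first exact/QE/dvdnn.
by move=> j j0 /QE; apply: dvdn_leq.
Qed.

Lemma smallest_positive_unique (Q : nat -> Prop) k k' :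
  smallest_positive Q k -> smallest_positive Q k' -> k = k'.
Proof.
by move=> [k0 Qk m] [k0' Qk' m']; apply/anti_leq; rewrite m// m'.
Qed.

(** * Classification of simple patterns by their lattice *)

Section Classification.
Variable M : nat.
Notation torus := ('Z_M * 'Z_M)%type.
Hypothesis M1 : (1 < M)%N.
Variable n : nat.
Implicit Type w : {ffun torus -> 'I_n}.
Notation simpleT := (@simple _ (@left M) (@down M) n).

(* Testing at the origin suffices for simple patterns, whose coincidences are
   translation invariant. *)
Definition has_periods w (t s : nat) : Prop :=
  smallest_positive (fun x => w (x%:R, 0) = w 0) s /\
  smallest_positive (fun y => w (0, y%:R) = w 0) t.

Lemma has_periods_row w t s : simpleT w -> has_periods w t s ->
  forall x, (w (x%:R, 0) == w 0) = (s %| x)%N.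
Proof.
move=> sw wp x.
have QD i j : w (i%:R, 0) = w 0 -> w (j%:R, 0) = w 0 <-> w ((i + j)%:R, 0) = w 0.
  move=> wi; have := simple_transl sw wi (j%:R, 0); rewrite add0r natrD.
  have -> : (i%:R, 0) + (j%:R, 0) = (i%:R + j%:R, 0) :> torus.
    by apply: injective_projections; rewrite //= addr0.
  by move=> ->.
by apply/eqP/idP => /(smallest_positive_dvd QD wp.1).
Qed.

Lemma has_periods_col w t s : simpleT w -> has_periods w t s ->
  forall y, (w (0, y%:R) == w 0) = (t %| y)%N.
Proof.
move=> sw wp y.
have QD i j : w (0, i%:R) = w 0 -> w (0, j%:R) = w 0 <-> w (0, (i + j)%:R) = w 0.
  move=> wi; have := simple_transl sw wi (0, j%:R); rewrite add0r natrD.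
  have -> : (0, i%:R) + (0, j%:R) = (0, i%:R + j%:R) :> torus.
    by apply: injective_projections; rewrite //= addr0.
  by move=> ->.
by apply/eqP/idP => /(smallest_positive_dvd QD wp.2).
Qed.

(* [s %/ gcdn s b] is the order of [b] in Z/s. *)
Definition admissible s t b := (s %/ gcdn s b %| t)%N.
(** Second coordinate of the generator [(b, height s t b)], chosen so that the vertical period is
    [t]. *)
Definition height s t b := (t %/ (s %/ gcdn s b))%N.
Definition in_class s t b w := respects (@lattice_eq M s b (height s t b)) w.

Lemma heightE s t b : admissible s t b -> t = (s %/ gcdn s b * height s t b)%N.
Proof. by move=> adm; rewrite mulnC divnK. Qed.

Lemma in_class_periods w s t b : (0 < s)%N -> (0 < t)%N ->
  (s %| M)%N -> (t %| M)%N -> admissible s t b ->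
  in_class s t b w -> has_periods w t s.
Proof.
move=> s0 t0 sM tM /heightE tE wr; split; apply: dvd_smallest_positive => // x.
  by rewrite -(respects_lattice_row M1 sM tM s0 t0 tE x wr); split=> /eqP.
by rewrite -(respects_lattice_col M1 sM tM s0 t0 tE x wr); split=> /eqP.
Qed.

(** The period vectors of [w] form a subgroup; a vector in its lowest row above 0, reduced modulo
    [(s, 0)], is the second generator. *)
Lemma exists_class w s t : simpleT w -> has_periods w t s ->
  exists2 b, (b < s)%N & admissible s t b && in_class s t b w.
Proof.
move=> sw wp; have rowE := has_periods_row sw wp; have colE := has_periods_col sw wp.
have [[s0 _ _] [t0 _ _]] := wp.
have wE g g' : (w g == w g') = (w (g - g') == w 0).
  apply/eqP/eqP => E; first by rewrite (simple_transl sw E) subrr.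
  by have := simple_transl sw E g'; rewrite subrK add0r.
have wD g h : w g == w 0 -> (w (g + h) == w 0) = (w h == w 0).
  by move=> /eqP E; rewrite (simple_transl sw E) add0r.
have wN g h : w g == w 0 -> (w (h - g) == w 0) = (w h == w 0).
  by move=> wg; rewrite -(wD _ _ wg) addrC subrK.
have wopp g : (w (- g) == w 0) = (w g == w 0).
  by apply/idP/idP => H; have := wN _ 0 H; rewrite sub0r ?opprK eqxx.
have wM g m : w g == w 0 -> w (g *+ m) == w 0.
  by move=> wg; elim: m => [|m IH]; rewrite ?mulr0n// mulrS wD.
(* [a] will be the least positive height of a period vector; [t] is one such height. *)
pose P a := (0 < a)%N && [exists x, w (x, a%:R) == w 0].
have exP : exists a, P a by exists t; rewrite /P t0/=; apply/existsP; exists 0; rewrite colE.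
pose a := ex_minn exP; have : P a /\ forall j, P j -> (a <= j)%N.
  by rewrite /a; case: ex_minnP.
move: a => a [/andP[a0 /existsP[x wxa]] amin].
pose b := (x %% s)%N.
have pairD (p q r u : 'Z_M) : (p, q) - (r, u) = (p - r, q - u) by [].
have wba : w (b%:R, a%:R) == w 0.
  have wr : w (((x %/ s) * s)%:R, 0) == w 0 by rewrite rowE dvdn_mull.
  rewrite -(wN _ _ wr) in wxa *; move: wxa; rewrite !(wN _ _ wr).
  rewrite -[X in (X, a%:R)]natr_Zp {1}(divn_eq x s) -(wN _ _ wr) pairD.
  by rewrite natrD addrC addKr subr0.
have wk k : w ((k * b)%:R, (k * a)%:R) == w 0.
  by have := wM _ k wba; rewrite pairMnE -!mulrnA !(mulnC k).
have dvd_a y k : w (y, k%:R) == w 0 -> (a %| k)%N.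
  move=> wyk; rewrite /dvdn; apply: contraT; rewrite -lt0n => r0.
  have H : ~~ [exists x, w (x, (k %% a)%:R) == w 0].
    apply/negP => E; have := amin (k %% a)%N; rewrite /P r0 E => /(_ isT).
    by rewrite leqNgt ltn_pmod.
  move/existsPn: H => /(_ (y - ((k %/ a) * b)%:R)) /negP[].
  rewrite -(wN _ _ (wk (k %/ a)%N)) in wyk; move: wyk.
  by rewrite pairD [X in (_, X%:R - _)](divn_eq k a) natrD addrAC subrr add0r.
have at_ : (a %| t)%N by apply: (dvd_a 0); rewrite colE.
(* Since [k * (b, a)] is a period vector, its horizontal part is a period exactly when its vertical
   part is, that is, [s | k * b] exactly when [t | k * a]. *)
have d_dvd k : (s %/ gcdn s b %| k)%N = (t %/ a %| k)%N.
  rewrite -dvdn_mul_gcd// -rowE -[RHS](dvdn_pmul2r a0) divnK// -colE.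
  rewrite -[RHS](wN _ _ (wk k)) pairD subrr sub0r.
  have -> : (- (k * b)%:R, 0) = - ((k * b)%:R, 0) :> torus.
    by apply: injective_projections; rewrite //= oppr0.
  by rewrite wopp.
have dE : (s %/ gcdn s b = t %/ a)%N.
  by apply/eqP; rewrite eqn_dvd d_dvd dvdnn -d_dvd dvdnn.
exists b; first by rewrite ltn_pmod.
have hE : height s t b = a.
  rewrite /height dE -[X in (X %/ _)%N](divnK at_) mulKn// divn_gt0//.
  exact: dvdn_leq.
rewrite /admissible d_dvd -{2}(divnK at_) dvdn_mulr//=.
rewrite /in_class hE; apply/respectsP => g g'; rewrite wE /lattice_eq.
move: (g - g') => [y z]; apply/idP/latticeP.
  rewrite -[z]natr_Zp => wyz; have /dvdnP[k kE] := dvd_a _ _ wyz.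
  move: wyz; rewrite kE -(wN _ _ (wk k)) pairD subrr -[_ - _]natr_Zp rowE.
  move=> /dvdnP[j jE]; exists k, j; congr (_, _).
  by rewrite natrD -jE natr_Zp addrC subrK.
move=> [k [j ->]]; rewrite -(wN _ _ (wk k)) pairD subrr natrD addrC addKr rowE.
by rewrite dvdn_mull.
Qed.

(** Each height divides the other, so they agree; then [(b - b', 0)] is a period vector, so [s]
    divides [b - b'], and both are below [s]. *)
Lemma class_unique w s t b b' : (s %| M)%N -> (t %| M)%N -> simpleT w ->
  has_periods w t s -> (b < s)%N -> (b' < s)%N ->
  admissible s t b -> in_class s t b w ->
  admissible s t b' -> in_class s t b' w -> b = b'.
Proof.
move=> sM tM sw wp bs bs' adm wr adm' wr'.
have rowE := has_periods_row sw wp.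
have [[s0 _ _] [t0 _ _]] := wp.
have wba c : in_class s t c w -> w (c%:R, (height s t c)%:R) == w 0.
  move=> /respectsP ->; rewrite /lattice_eq subr0; apply/latticeP.
  by exists 1%N, 0%N; rewrite mul0n addn0 !mul1n.
have hM c : admissible s t c -> (height s t c %| M)%N.
  by move=> /heightE tEc; apply: dvdn_trans tM; rewrite [X in (_ %| X)%N]tEc dvdn_mull.
have hdvd c c' : admissible s t c -> in_class s t c w ->
    admissible s t c' -> in_class s t c' w -> (height s t c' %| height s t c)%N.
  move=> ac cc ac' /respectsP cc'; have := wba _ cc.
  rewrite cc' /lattice_eq subr0 => /latticeP[k [j [_ E]]].
  by rewrite /dvdn (eq_Zp_dvd M1 (hM _ ac') E) modnMl.
have hh : height s t b = height s t b'.
  by apply/eqP; rewrite eqn_dvd !hdvd.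
wlog le : b b' bs bs' adm wr adm' wr' hh / (b' <= b)%N => [wl|].
  by have [/wl|/ltnW/wl] := leqP b' b; [apply|move=> H; apply/esym/H].
suff : (s %| b - b')%N.
  move=> /dvdn_leq; have [|_ /(_ isT)] := posnP (b - b')%N; last by lia.
  by lia.
rewrite -rowE natrB//; have := simple_transl sw (eqP (wba _ wr))
  (- (b'%:R, (height s t b')%:R)).
have -> : (b%:R, (height s t b)%:R) - (b'%:R, (height s t b')%:R) =
    (b%:R - b'%:R, 0) :> torus.
  by apply: injective_projections; rewrite //= hh subrr.
move=> ->; rewrite add0r; apply/eqP.
have := simple_transl sw (eqP (wba _ wr')) (- (b'%:R, (height s t b')%:R)).
by rewrite subrr add0r => ->.
Qed.

Lemma sum_cond_unique (V : nmodType) (I : eqType) (r : seq I) (P : pred I) (x : V) :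
  uniq r -> {in r &, forall i j, P i -> P j -> i = j} ->
  \sum_(i <- r | P i) x = if has P r then x else 0.
Proof.
elim: r => [|i r IH] /=; first by rewrite big_nil.
move=> /andP[ir ur] Pinj; rewrite big_cons.
case Pi : (P i) => /=.
  rewrite big1_seq ?addr0// => j /andP[Pj jr]; case/negP: ir.
  by rewrite (Pinj i j)// inE ?eqxx// jr orbT.
apply: IH => // j k jr kr; apply: Pinj; by rewrite inE ?jr ?kr orbT.
Qed.

Variable ts : seq (nat * nat).
Hypothesis ts_uniq : uniq ts.
Hypothesis ts_pos : {in ts, forall p, (0 < p.1)%N && (0 < p.2)%N}.
Hypothesis ts_dvd : {in ts, forall p, (p.1 %| M)%N && (p.2 %| M)%N}.

(** The representatives counted by [lambda]: up to O(1/n), a periodic solution exists exactly when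
    one of them is generated. *)
Definition target w :=
  simpleT w && pinned w && has (fun p => `[< has_periods w p.1 p.2 >]) ts.

(** A target has a single pair of periods and, by [exists_class] and [class_unique], a single [b];
    on that class the number of states is the lattice index. *)
Lemma sum_target (V : nmodType) (F : nat -> V) :
  \sum_(w | target w) F #|codom w| =
  \sum_(p <- ts) \sum_(b < p.2 | admissible p.2 p.1 b)
     F (p.2 * height p.2 p.1 b)%N
       *+ #|fun w => in_class p.2 p.1 b w && pinned w|.
Proof.
transitivity (\sum_(w | simpleT w && pinned w)
    \sum_(p <- ts | `[< has_periods w p.1 p.2 >]) F #|codom w|).
  rewrite [RHS](eq_bigr (fun w =>
    if has (fun p => `[< has_periods w p.1 p.2 >]) ts then F #|codom w| else 0)).
    by rewrite -big_mkcondr.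
  move=> w _; apply: sum_cond_unique => // -[t s] [t' s'] _ _.
  move=> /asboolP[/= sP tP] /asboolP[/= sP' tP'].
  by rewrite (smallest_positive_unique sP sP') (smallest_positive_unique tP tP').
rewrite (exchange_big_dep predT)//= big_seq [RHS]big_seq; apply: eq_bigr => -[t s] tsP /=.
have /andP[/= t0 s0] := ts_pos tsP; have /andP[/= tM sM] := ts_dvd tsP.
transitivity (\sum_(w | simpleT w && pinned w && `[< has_periods w t s >])
    \sum_(b < s | admissible s t b && in_class s t b w) F #|codom w|).
  apply: eq_bigr => w /andP[/andP[sw _] /asboolP wp].
  rewrite sum_cond_unique ?index_enum_uniq//; last first.
    move=> b b' _ _ /andP[ab cb] /andP[ab' cb']; apply/val_inj.
    exact: (@class_unique w s t b b').
  case: hasP => // -[]; have [b bs bw] := exists_class sw wp.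
  by exists (Ordinal bs); rewrite ?mem_index_enum.
rewrite (exchange_big_dep (fun b : 'I_s => admissible s t b))/=; last first.
  by move=> w b _ /andP[].
apply: eq_bigr => b ab; have tE := heightE ab.
rewrite -sumr_const; apply: eq_big => [w|w /andP[_ /andP[_ cb]]]; last first.
  by rewrite (card_codom_lattice M1 sM tM s0 t0 tE cb).
rewrite ab /= /in_mem /= andbC; apply/andP/andP => [[cb /andP[/andP[_ pw] _]]|[cb pw]] //.
split=> //; rewrite pw andbT (respects_lattice_simple cb)//=.
by apply/asboolP; apply: in_class_periods cb.
Qed.

Lemma card_class_pinned s t b : (0 < s)%N -> (0 < t)%N ->
  (s %| M)%N -> (t %| M)%N -> admissible s t b ->
  (s * height s t b * #|fun w => in_class s t b w && pinned w|
   = n ^_ (s * height s t b))%N.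
Proof.
by move=> s0 t0 sM tM /heightE tE; apply: (card_lattice_pinned M1 sM tM s0 t0 tE).
Qed.
End Classification.

(** * The constant lambda and limits *)

(** With [s = e * d], these [b] are the [e * k] with [k < d] coprime to [d]. *)
Lemma card_gcd_totient s d : (0 < s)%N -> (d %| s)%N ->
  #|fun b : 'I_s => (s %/ gcdn s b == d)%N| = totient d.
Proof.
move=> s0 /dvdnP[e sE].
have [e0 d0] : (0 < e)%N /\ (0 < d)%N.
  by move: s0; rewrite sE muln_gt0 => /andP[].
have hlt (k : 'I_d) : (e * k < s)%N by rewrite sE ltn_pmul2l.
pose h k := Ordinal (hlt k).
have hinj : injective h.
  by move=> k k' /(congr1 val)/eqP /=; rewrite eqn_pmul2l// => /eqP/val_inj.
rewrite totient_count_coprime big_mkord -big_mkcond/= sum1_card.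
rewrite -(fintype.card_image hinj); apply: eq_card => b.
apply/idP/fintype.imageP => [/eqP bE|[k]].
  have gE : gcdn s b = e.
    apply/eqP; rewrite -(eqn_pmul2r d0) -sE -{1}bE mulnC divnK//.
    exact: dvdn_gcdl.
  have /dvdnP[k kE] : (e %| b)%N by rewrite -gE dvdn_gcdr.
  have kd : (k < d)%N by rewrite -(ltn_pmul2r e0) -kE (mulnC d) -sE.
  exists (Ordinal kd); last by apply/val_inj; rewrite /= kE mulnC.
  apply/eqP/eqP; rewrite -(eqn_pmul2l e0) muln_gcdr muln1.
  by rewrite -sE (mulnC e k) -kE gE.
move=> /eqP kd ->; rewrite /in_mem /=.
by rewrite sE -muln_gcdr kd muln1 mulKn.
Qed.

(** Group the [b] by their order [d] in Z/s; admissibility says that [d] divides [t]. *)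
Lemma sum_gcd_totient s t : (0 < s)%N ->
  (\sum_(b < s | admissible s t b) s %/ gcdn s b =
   \sum_(d <- divisors (gcdn t s)) totient d * d)%N.
Proof.
move=> s0; have g0 : (0 < gcdn t s)%N by rewrite gcdn_gt0 s0 orbT.
transitivity (\sum_(b < s) \sum_(d <- divisors (gcdn t s) | (s %/ gcdn s b == d)%N) d)%N.
  rewrite big_mkcond/=; apply: eq_bigr => b _.
  rewrite (eq_bigr (fun=> (s %/ gcdn s b)%N)); last by move=> d /eqP.
  rewrite sum_cond_unique ?divisors_uniq//; last by move=> d d' _ _ /eqP <- /eqP.
  congr (if _ then _ else _); apply/idP/hasP => [adm|[d dg /eqP dE]].
    exists (s %/ gcdn s b)%N => //.
    rewrite -dvdn_divisors// dvdn_gcd; apply/andP; split=> //.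
    by rewrite -[X in (_ %| X)%N](divnK (dvdn_gcdl s b)) dvdn_mulr.
  by move: dg; rewrite -dvdn_divisors// dvdn_gcd /admissible dE => /andP[].
rewrite (exchange_big_dep predT)//= big_seq [RHS]big_seq; apply: eq_bigr => d.
rewrite -dvdn_divisors// dvdn_gcd => /andP[_ ds].
by rewrite sum_nat_const card_gcd_totient.
Qed.

(** As [t = d * height s t b], each term equals [d / (s * t)]. *)
Lemma lambda_sum (R : realType) t s : (0 < s)%N -> (0 < t)%N ->
  \sum_(b < s | admissible s t b) ((s * height s t b)%:R)^-1 = lambda R t s.
Proof.
move=> s0 t0; rewrite /lambda mul1r -natr_sum -sum_gcd_totient// natr_sum mulr_sumr.
apply: eq_bigr => b /heightE; set d := (s %/ gcdn s b)%N => tE.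
have : (0 < d * height s t b)%N by rewrite -tE.
rewrite muln_gt0 !lt0n => /andP[d0 h0].
rewrite [in RHS]tE !natrM; field.
by rewrite !pnatr_eq0 d0 h0 -lt0n s0.
Qed.

Section Limits.
Variable R : realType.

Lemma cvg_invn : (n%:R^-1 : R) @[n --> \oo] --> (0 : R).
Proof. by rewrite -cvg_shiftS; apply: cvg_harmonic. Qed.

Lemma cvg_ffact k : ((n ^_ k)%:R / n%:R ^+ k : R) @[n --> \oo] --> (1 : R).
Proof.
elim: k => [|k IH].
  by under eq_fun do rewrite ffactn0 expr0 divr1; apply: cvg_cst.
have -> : (fun n : nat => (n ^_ k.+1)%:R / n%:R ^+ k.+1 : R) =
    (fun n => ((n ^_ k)%:R / n%:R ^+ k) * ((n - k)%:R / n%:R)).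
  apply/funext => n; rewrite ffactnSr natrM exprSr invfM; ring.
rewrite -[X in _ --> X]mulr1; apply: cvgM IH _.
have : (1 - k%:R * n%:R^-1 : R) @[n --> \oo] --> (1 : R).
  rewrite -[X in _ --> X]subr0; apply: cvgB; first exact: cvg_cst.
  by rewrite -[X in _ --> X](mulr0 k%:R); apply: cvgMr; apply: cvg_invn.
apply: cvg_trans; apply: near_eq_cvg; near=> n.
have kn : (k < n)%N by near: n; exists k.+1.
rewrite natrB 1?ltnW// mulrBl divff// pnatr_eq0.
by rewrite -lt0n (leq_trans _ kn).
Unshelve. all: by end_near. Qed.

Lemma prod_le_exp (I : eqType) (s : seq I) (p : I -> R) :
  {in s, forall i, 0 <= p i <= 1} ->
  \prod_(i <- s) (1 - p i) <= expR (- \sum_(i <- s) p i).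
Proof.
move=> p01; rewrite -sumrN expR_sum big_seq [leRHS]big_seq.
apply: ler_prod => i /p01/andP[p0 p1]; rewrite subr_ge0 p1/=.
exact: expR_ge1Dx.
Qed.

Lemma prod_ge_exp (I : eqType) (s : seq I) (p : I -> R) e : 0 <= e <= 2^-1 ->
  {in s, forall i, 0 <= p i <= e} ->
  expR (- ((1 + 2 * e) * \sum_(i <- s) p i)) <= \prod_(i <- s) (1 - p i).
Proof.
move=> /andP[e0 e2] pe; rewrite mulr_sumr -sumrN expR_sum big_seq [leRHS]big_seq.
apply: ler_prod => i /pe/andP[p0 pe1]; rewrite expR_ge0/=.
(* Inverted, the claim follows from [1 / (1 - p) <= 1 + (1 + 2 * e) * p], which holds because
   [p <= e <= 1/2]. *)
rewrite expRN -[leRHS]invrK lef_pV2 ?posrE ?invr_gt0 ?expR_gt0//; last by lra.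
apply: le_trans (expR_ge1Dx _).
rewrite -[leLHS]mul1r ler_pdivrMr; last by lra.
have : p i * p i <= e * p i by rewrite ler_wpM2r.
have : p i * p i <= p i / 2 by rewrite ler_wpM2l//; lra.
have : e * p i * p i <= e * p i / 2 by rewrite ler_wpM2l ?mulr_ge0//; lra.
nra.
Qed.

End Limits.

(** * Periodic solutions and torus patterns *)

Section Correspondence.
Variables (M n : nat) (f : rule n).
Notation torus := ('Z_M * 'Z_M)%type.
Hypothesis M1 : (1 < M)%N.
Implicit Types (w : {ffun torus -> 'I_n}) (xi : spacetime n).
Notation simpleT := (@simple _ (@left M) (@down M) n).
Notation genT := (@gen _ (@left M) (@down M) n).

Lemma smallest_positive_iff (P Q : nat -> Prop) k :
  (forall i, P i <-> Q i) -> smallest_positive P k -> smallest_positive Q k.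
Proof.
move=> PQ [k0 Pk kmin]; split=> //; first exact/PQ.
by move=> j j0 /PQ; apply: kmin.
Qed.

Definition unroll w : spacetime n := fun t x => w (x%:~R, t%:R).

Lemma generated_unroll w : genT w f -> generated f (unroll w).
Proof.
move=> /genP wf t x; rewrite /unroll; have := wf (x%:~R, t%:R).
by rewrite /left /down /= natr1 rmorphB => ->.
Qed.

Lemma unroll_row w : simpleT w ->
  forall k : nat, (forall x : int, unroll w 0%N (x + k%:Z) = unroll w 0%N x) <->
    w (k%:R, 0) = w 0.
Proof.
move=> sw k; split=> [/(_ 0)|wk x]; first by rewrite /unroll add0r.
have := simple_transl sw wk (x%:~R, 0); rewrite add0r /unroll => <-.
congr (w _); apply: injective_projections; rewrite /= ?addr0//.
by rewrite rmorphD addrC.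
Qed.

Lemma unroll_col w : simpleT w ->
  forall k : nat, (forall x : int, unroll w k x = unroll w 0%N x) <->
    w (0, k%:R) = w 0.
Proof.
move=> sw k; split=> [/(_ 0)|wk x]; first by rewrite /unroll.
have := simple_transl sw wk (x%:~R, 0); rewrite add0r /unroll => <-.
by congr (w _); apply: injective_projections; rewrite /= ?addr0 ?add0r.
Qed.

Lemma periodic_unroll w t s : simpleT w -> genT w f ->
  periodic_solution f t s (unroll w) <-> has_periods w t s.
Proof.
move=> sw wf; have rowE := unroll_row sw; have colE := unroll_col sw.
split=> [[_ sP tP]|[sP tP]].
  by split; [apply: smallest_positive_iff sP|apply: smallest_positive_iff tP].
split; first exact: generated_unroll.
  by apply: smallest_positive_iff sP => k; symmetry.
by apply: smallest_positive_iff tP => k; symmetry.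
Qed.

Lemma periodic_row xi s : generated f xi ->
  (forall x : int, xi 0%N (x + s%:Z) = xi 0%N x) ->
  forall t x, xi t (x + s%:Z) = xi t x.
Proof.
move=> gxi xi0; elim=> // t IH x.
by rewrite !gxi -(IH (x - 1)) IH addrAC.
Qed.

Lemma periodic_col xi t : generated f xi ->
  (forall x : int, xi t x = xi 0%N x) -> forall r x, xi (r + t)%N x = xi r x.
Proof.
by move=> gxi xi0; elim=> [x|r IH x]; rewrite ?add0n// addSn !gxi !IH.
Qed.

Definition roll xi : {ffun torus -> 'I_n} :=
  [ffun g : torus => xi (g.2 : nat) ((g.1 : nat)%:Z)].

(** Both periods divide [M], so reducing both coordinates modulo [M] does not change the state. *)
Lemma unroll_roll xi t s : (t %| M)%N -> (s %| M)%N ->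
  periodic_solution f t s xi -> forall r x, xi r x = unroll (roll xi) r x.
Proof.
move=> /dvdnP[p tM] /dvdnP[q sM] [gxi [_ xis _] [_ xit _]] r x.
have rowM r' : forall y, xi r' (y + M%:Z) = xi r' y.
  have := periodic_row gxi xis r' => row.
  have H c y : xi r' (y + (c * s)%:Z) = xi r' y.
    elim: c y => [|c IH] y; first by rewrite mul0n addr0.
    by rewrite mulSn addnC PoszD addrA row IH.
  by rewrite sM.
have rowZ r' (y : int) (c : int) : xi r' (y + c * M%:Z) = xi r' y.
  have Hn (m : nat) z : xi r' (z + m%:Z * M%:Z) = xi r' z.
    elim: m z => [|m IH] z; first by rewrite mul0r addr0.
    by rewrite -addn1 PoszD mulrDl mul1r addrA rowM IH.
  case: c => m; first exact: Hn.
  (* For a negative coefficient, the opposite multiple of [M] is added back. *)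
  by rewrite -[LHS](Hn m.+1) -addrA -mulrDl NegzE addNr mul0r addr0.
have colM r' c y : xi (r' + c * M)%N y = xi r' y.
  elim: c => [|c IH]; first by rewrite mul0n addn0.
  have col c' r2 z : xi (r2 + c' * t)%N z = xi r2 z.
    elim: c' => [|c' IH']; first by rewrite mul0n addn0.
    by rewrite mulSn [(t + _)%N]addnC addnA periodic_col.
  by rewrite mulSn [(M + _)%N]addnC addnA {2}tM col.
rewrite /unroll ffunE /=.
have M0 : M%:Z != 0 by rewrite -lt0n ltnW.
have xE : (x%:~R : 'Z_M) = `|(x %% M)%Z|%N%:R.
  rewrite {1}(divz_eq x M) rmorphD rmorphM /=.
  have -> : (M%:Z%:~R : 'Z_M) = 0 by rewrite -pmulrn pchar_Zp.
  by rewrite mulr0 add0r -[X in X%:~R]gez0_abs ?modz_ge0// -pmulrn.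
have lt : (`|(x %% M)%Z| < M)%N.
  by rewrite -ltz_nat gez0_abs ?modz_ge0// ltz_pmod// ltz_nat ltnW.
rewrite xE !val_Zp_nat// (modn_small lt) gez0_abs ?modz_ge0//.
by rewrite {1}(divn_eq r M) addnC colM {1}(divz_eq x M) addrC rowZ.
Qed.

Lemma roll_gen xi t s : (t %| M)%N -> (s %| M)%N ->
  periodic_solution f t s xi -> genT (roll xi) f.
Proof.
move=> tM sM per; have rollE := unroll_roll tM sM per; have [gxi _ _] := per.
apply/genP => -[x y]; have := gxi (y : nat) ((x : nat)%:Z).
by rewrite !rollE /unroll -natr1 rmorphB /= -pmulrn !natr_Zp => ->.
Qed.

Lemma roll_has_periods xi t s : (t %| M)%N -> (s %| M)%N -> simpleT (roll xi) ->
  periodic_solution f t s xi -> has_periods (roll xi) t s.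
Proof.
move=> tM sM sw per; have wf := roll_gen tM sM per.
apply/(periodic_unroll t s sw wf).
by have -> : unroll (roll xi) = xi by
  apply/funext => r; apply/funext => x; rewrite -(unroll_roll tM sM per).
Qed.

Lemma has_periods_transl g w t s : simpleT w -> has_periods w t s ->
  has_periods (transl g w) t s.
Proof.
move=> sw [sP tP].
have E h : w h = w 0 <-> transl g w h = transl g w 0.
  rewrite !ffunE addr0; split=> H.
    by have := simple_transl sw H g; rewrite add0r addrC.
  by have := simple_transl sw H (- g); rewrite subrr addrAC subrr add0r.
by split; [apply: smallest_positive_iff sP|apply: smallest_positive_iff tP].
Qed.

End Correspondence.

(** * Probability bounds and convergence *)

Section Convergence.
Variables (R : realType) (M : nat) (T S : set nat) (ts : seq (nat * nat)).
Hypothesis M1 : (1 < M)%N.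
Hypothesis ts_uniq : uniq ts.
Hypothesis TS : T `*` S = [set` ts].
Hypothesis ts_pos : {in ts, forall p, (0 < p.1)%N && (0 < p.2)%N}.
Hypothesis ts_dvd : {in ts, forall p, (p.1 %| M)%N && (p.2 %| M)%N}.
Notation torus := ('Z_M * 'Z_M)%type.

Lemma PS_target n (f : rule n) w : @target M n ts w -> gen (@left M) (@down M) w f ->
  PS_family f T S !=set0.
Proof.
move=> /andP[/andP[sw pw] /hasP[[t s] tsP /asboolP/= wp]] wf.
exists (translates (unroll w)), (t, s); first by rewrite TS.
by exists (unroll w) => //; apply/periodic_unroll.
Qed.

(** Rolled up on the torus, a periodic solution is a generated pattern; if it is simple, its pinned
    translate is a target. *)
Lemma PS_exists n (f : rule n) : PS_family f T S !=set0 ->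
  [exists w : {ffun torus -> 'I_n}, target ts w && gen (@left M) (@down M) w f] ||
  [exists w : {ffun torus -> 'I_n},
     ~~ simple (@left M) (@down M) w && gen (@left M) (@down M) w f].
Proof.
move=> [Z [[t s]]]; rewrite TS => tsP [xi /= per _].
have /andP[/= tM sM] := ts_dvd tsP.
have wf := roll_gen M1 tM sM per.
apply/orP; case sw : (simple (@left M) (@down M) (roll M xi)); last first.
  by right; apply/existsP; exists (roll M xi); rewrite sw.
left; have [g gp] := pinned_transl (roll M xi).
apply/existsP; exists (transl g (roll M xi)); rewrite gen_transl// andbT.
rewrite /target simple_transl_config// gp/=; apply/hasP; exists (t, s) => //=.
by apply/asboolP/has_periods_transl => //; apply: roll_has_periods per.
Qed.

Lemma rule_probE n (A : set (rule n)) :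
  rule_prob R A = pr R (fun f : {ffun 'I_n * 'I_n -> 'I_n} => f \in A).
Proof.
rewrite /rule_prob /pr sumr_const mulrC -mulrnAl card_ffun card_prod !card_ord.
by rewrite mulr1 -[LHS]mulr_natl mulnn; congr (_%:R / _); apply: eq_card => f.
Qed.

(** For [n > 0], the expected number of targets generated by the random rule: being simple, a target
    with [k] states has probability [n^-k]. *)
Definition mean n : R :=
  \sum_(w : {ffun torus -> 'I_n} | target ts w) n%:R ^- #|codom w|.

(** By [card_class_pinned], a class of index [k] has [n ^_ k / k] pinned members. *)
Lemma meanE n : (0 < n)%N ->
  mean n = \sum_(p <- ts) \sum_(b < p.2 | admissible p.2 p.1 b)
  ((n ^_ (p.2 * height p.2 p.1 b))%:R / n%:R ^+ (p.2 * height p.2 p.1 b)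
    * ((p.2 * height p.2 p.1 b)%:R)^-1).
Proof.
move=> n0; rewrite /mean (sum_target M1 _ ts_uniq ts_pos ts_dvd (fun k => n%:R ^- k)).
rewrite big_seq [RHS]big_seq; apply: eq_bigr => -[t s] tsP /=; apply: eq_bigr => b adm.
have /andP[/= t0 s0] := ts_pos tsP; have /andP[/= tM sM] := ts_dvd tsP.
have := card_class_pinned M1 n s0 t0 sM tM adm => <-.
have k0 : (0 < s * height s t b)%N.
  by rewrite muln_gt0 s0 /=; move: t0; rewrite {1}(heightE adm) muln_gt0 => /andP[].
move: (s * _)%N k0 #|_| => k k0 c; rewrite natrM -[LHS]mulr_natl; field.
by rewrite expf_neq0 ?pnatr_eq0 -?lt0n ?k0.
Qed.

Lemma cvg_mean : mean n @[n --> \oo] --> lambda_family R T S.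
Proof.
have -> : lambda_family R T S = \sum_(p <- ts) lambda R p.1 p.2.
  by rewrite /lambda_family TS -fsbig_seq.
have -> : \sum_(p <- ts) lambda R p.1 p.2 =
    \sum_(p <- ts) \sum_(b < p.2 | admissible p.2 p.1 b)
      ((p.2 * height p.2 p.1 b)%:R)^-1.
  rewrite big_seq [RHS]big_seq; apply: eq_bigr => p /ts_pos/andP[t0 s0].
  by rewrite lambda_sum.
have : (\sum_(p <- ts) \sum_(b < p.2 | admissible p.2 p.1 b)
  ((n ^_ (p.2 * height p.2 p.1 b))%:R / n%:R ^+ (p.2 * height p.2 p.1 b)
    * ((p.2 * height p.2 p.1 b)%:R)^-1)) @[n --> \oo] -->
    (\sum_(p <- ts) \sum_(b < p.2 | admissible p.2 p.1 b)
       ((p.2 * height p.2 p.1 b)%:R)^-1 : R).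
  apply: cvg_big => [|p _]; first exact: add_continuous.
  apply: cvg_big => [|b _]; first exact: add_continuous.
  by rewrite -[X in _ --> X]mul1r; apply: cvgMl; apply: cvg_ffact.
apply: cvg_trans; apply: near_eq_cvg; near=> n.
by rewrite meanE//; near: n; exists 1%N.
Unshelve. all: by end_near. Qed.

(** The first term pays for non-simple patterns, the second for dependent pairs of targets. *)
Let C : R := (config_bound (torus : finType))%:R
  + 2 * (config_bound (torus + torus)%type)%:R.

(** Existence of a periodic solution lies between generating a target and generating a target or a
    non-simple pattern; the product approximating avoidance of all targets lies between two
    exponentials. *)
Lemma prob_bounds n : (1 < n)%N ->
  1 - expR (- mean n) - C * n%:R^-1 <=
  rule_prob R [set f : rule n | PS_family f T S !=set0] <=
  1 - expR (- ((1 + 2 * n%:R^-1) * mean n)) + C * n%:R^-1.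
Proof.
move=> n1; have n0 : (0 < n)%N by apply: ltnW.
set E := [set f | _]; rewrite rule_probE.
set s := enum (fun w : {ffun torus -> 'I_n} => target ts w).
have su : uniq s by apply: enum_uniq.
have sP : {in s, forall w, simple (@left M) (@down M) w && pinned w}.
  by move=> w; rewrite mem_enum => /andP[].
pose A := gen (@left M) (@down M) (n := n).
have /ler_normlP[] := gen_avoids_approx R n0 su sP.
set Q := pr R (avoids _ _); set Pi := \prod_(_ <- _) _; move=> QP PQ.
have meanS : mean n = \sum_(w <- s) n%:R ^- #|codom w|.
  by rewrite /s big_enum; apply: eq_bigl.
(* [prod_ge_exp] is applied with [e = 1/n], which is at most [1/2] because [1 < n]. *)
have inv_n : 0 <= (n%:R^-1 : R) <= 2^-1.
  by rewrite invr_ge0 ler0n/= lef_pV2 ?posrE ?ltr0n// ler_nat.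
have p_bound (w : {ffun torus -> 'I_n}) : 0 <= (n%:R ^- #|codom w| : R) <= n%:R^-1.
  rewrite invr_ge0 exprn_ge0//= lef_pV2 ?posrE ?exprn_gt0 ?ltr0n//.
  rewrite -[leLHS]expr1 ler_weXn2l ?ler1n//; apply/card_gt0P.
  by exists (w 0); apply: codom_f.
have PiU : Pi <= expR (- mean n).
  rewrite meanS; apply: prod_le_exp => w _; have /andP[-> /le_trans ->//] := p_bound w.
  by rewrite invf_le1 ?ltr0n// ler1n.
have PiL : expR (- ((1 + 2 * n%:R^-1) * mean n)) <= Pi.
  by rewrite meanS; apply: prod_ge_exp => // w _.
have F0 : (0 < #|{ffun 'I_n * 'I_n -> 'I_n}|)%N by rewrite card_ffun card_ord expn_gt0 n0.
have hasQ : pr R (fun f => has (A^~ f) s) = 1 - Q.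
  rewrite -(pr_predT R F0) (pr_split R (fun f => has (A^~ f) s) predT) /=.
  by rewrite addrK.
have lowE : 1 - Q <= pr R (fun f => f \in E).
  rewrite -hasQ; apply: pr_le => f /hasP[w]; rewrite mem_enum => wt wf.
  by apply/mem_set; apply: PS_target wf.
have upE : pr R (fun f => f \in E) <= 1 - Q + (config_bound (torus : finType))%:R / n%:R.
  apply: le_trans (_ : pr R (fun f => has (A^~ f) s) +
     pr R (fun f => [exists w, ~~ simple (@left M) (@down M) w && A w f]) <= _); last first.
    by rewrite hasQ lerD2l; apply: pr_not_simple_le.
  rewrite (pr_split R (fun f => has (A^~ f) s)) lerD//.
    by apply: pr_le => f /andP[].
  apply: pr_le => f /andP[/set_mem/PS_exists/orP[/existsP[w /andP[wt wf]]|//]].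
  by case/hasP; exists w => //; rewrite mem_enum.
move: QP PQ lowE upE PiU PiL; rewrite /C mulrDl.
move=> *; apply/andP; split; lra.
Qed.
End Convergence.

Theorem theorem2 (R : realType) (T S : set nat)
    (T_pos : forall tau : nat, T tau -> (0 < tau)%N)
    (S_pos : forall sigma : nat, S sigma -> (0 < sigma)%N)
    (TS_finite : finite_set (T `*` S)) :
  rule_prob R [set f : rule n | PS_family f T S !=set0] @[n --> \oo]
    --> 1 - expR (- lambda_family R T S).
Proof.
have /finite_seqP[ts0 ts0E] := TS_finite.
pose ts := undup ts0.
have TS : T `*` S = [set` ts].
  by rewrite ts0E; apply/seteqP; split => p /=; rewrite mem_undup.
have ts_pos : {in ts, forall p, (0 < p.1)%N && (0 < p.2)%N}.
  move=> p pts; have [Tp Sp] : (T `*` S) p by rewrite TS.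
  by rewrite T_pos// S_pos.
pose B := \max_(p <- ts) maxn p.1 p.2.
(* The factorial is a common multiple of all the periods; the shift by 2 gives [1 < M] even when
   [ts] is empty. *)
pose M := (B.+2)`!.
have M1 : (1 < M)%N by apply: leq_trans (fact_geq _).
have ts_dvd : {in ts, forall p, (p.1 %| M)%N && (p.2 %| M)%N}.
  move=> p pts; have /andP[p1 p2] := ts_pos _ pts.
  have : (maxn p.1 p.2 <= B)%N by apply: (leq_bigmax_seq p).
  rewrite geq_max => /andP[h1 h2].
  by rewrite !dvdn_fact ?p1 ?p2 ?(leq_trans h1) ?(leq_trans h2)// leqW.
have ts_uniq : uniq ts by apply: undup_uniq.
have mean_cvg := cvg_mean (R := R) M1 ts_uniq TS ts_pos ts_dvd.
have inv_cvg := @cvg_invn R.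
have exp_cvg (u : nat -> R) l : u n @[n --> \oo] --> l ->
    1 - expR (- u n) @[n --> \oo] --> 1 - expR (- l).
  move=> ul; apply: cvgB; first exact: cvg_cst.
  by apply: continuous_cvg; [apply: continuous_expR|apply: cvgN].
have err_cvg (c : R) : c * n%:R^-1 @[n --> \oo] --> (0 : R).
  by rewrite -[X in _ --> X](mulr0 c); apply: cvgMr.
(* Both bounds have the same limit, since [1 + 2/n] tends to 1 and the error term to 0. *)
apply: squeeze_cvgr.
- near=> n; apply: (prob_bounds R M1 TS ts_dvd).
  by near: n; exists 2%N.
- rewrite -[X in _ --> X]subr0; apply: cvgB => //; exact: exp_cvg.
- rewrite -[X in _ --> X]addr0; apply: cvgD => //; apply: exp_cvg.
  rewrite -[X in _ --> X]mul1r; apply: cvgM => //.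
  by rewrite -[X in _ --> X]addr0; apply: cvgD => //; apply: cvg_cst.
Unshelve. all: by end_near. Qed.
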